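(* For every $n\geq 4$, $L(K_n)$ has no proper Galvin orientation with respect to $\chi'(K_n)$.
   Context: A $k$-edge-colouring is an assignment of colours from $\{1,\dots,k\}$ to edges so that adjacent edges get different colours; $\chi'$ is the chromatic index. The line graph $L(G)$ has vertex set $E(G)$, and two edges $e,f$ of $G$ are joined in $L(G)$ by as many edges as the number of ends they share in $G$; each edge of $L(G)$ corresponds to a common incidence of its two ends at a vertex of $G$. Given a partition of $V(G)$ into sets $U$ and $D$ and a $k$-edge-colouring $\varphi$ of $G$, the Galvin orientation of $L(G)$ is defined as follows: for an edge of $L(G)$ with ends $e_1,e_2$, where $\varphi(e_1)<\varphi(e_2)$, corresponding to a common incidence at a vertex $x$ of $G$: if $x\in D$ it is oriented from $e_2$ to $e_1$, and if $x\in U$ it is oriented from $e_1$ to $e_2$. A kernel of a digraph is an independent set $K$ such that every vertex outside $K$ has an out-edge into $K$; a digraph is kernel-perfect if every induced subdigraph has a kernel. The Galvin orientation is proper if it is kernel-perfect and every vertex has outdegree at most $k-1$. $L(G)$ has a proper Galvin orientation with respect to $k$ if there exist a partition $(U,D)$ of $V(G)$ and a $k$-edge-colouring $\varphi$ of $G$ whose Galvin orientation is proper. *)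

(* Defs.v *)
From mathcomp Require Import all_boot.

Set Implicit Arguments.
Unset Strict Implicit.
Unset Printing Implicit Defensive.

(* Finite loopless multigraphs: parallel edges are allowed. *)
Record mgraph := MGraph {
  vertex : finType;
  edge : finType;
  ends : edge -> {set vertex};
  card_ends : forall e : edge, #|ends e| = 2 }.

Definition complete_edge (n : nat) := {e : {set 'I_n} | #|e| == 2}.

Definition complete (n : nat) : mgraph :=
  @MGraph 'I_n (complete_edge n) val (fun e => eqP (valP e)).

(* The colours are 0, ..., k-1 instead of 1, ..., k; only their order matters. *)
Definition is_edge_colouring (G : mgraph) (k : nat) (phi : edge G -> 'I_k) : bool :=
  [forall e : edge G, forall f : edge G,
     (e != f) && (ends e :&: ends f != set0) ==> (phi e != phi f)].

Definition edge_colourable (G : mgraph) (k : nat) : bool :=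
  [exists phi : {ffun edge G -> 'I_k}, is_edge_colouring phi].

Lemma edge_colourable_exists (G : mgraph) : exists k, edge_colourable G k.
Proof.
exists #|edge G|; apply/existsP; exists [ffun e => enum_rank e].
apply/forallP=> e; apply/forallP=> f; apply/implyP=> /andP[ef _].
by rewrite !ffunE (inj_eq enum_rank_inj).
Qed.

Definition chromatic_index (G : mgraph) : nat := ex_minn (edge_colourable_exists G).

(* An edge of L(G) is a pair ({e, f}, x) with e != f and x a common end of e and
   f, so that e and f are joined once for every end they share. *)
Definition line_edge (G : mgraph) :=
  {p : {set edge G} * vertex G |
     (#|p.1| == 2) && [forall e in p.1, p.2 \in ends e]}.

Definition line_ends (G : mgraph) (l : line_edge G) : {set edge G} := (val l).1.

Definition incidence (G : mgraph) (l : line_edge G) : vertex G := (val l).2.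

Lemma card_line_ends (G : mgraph) (l : line_edge G) : #|line_ends l| = 2.
Proof. by apply/eqP; case/andP: (valP l). Qed.

Definition line_graph (G : mgraph) : mgraph := MGraph (@card_line_ends G).

Record digraph := Digraph {
  node : finType;
  arc : finType;
  tail : arc -> node;
  head : arc -> node }.

Definition outdegree (H : digraph) (v : node H) : nat :=
  #|[set a : arc H | tail a == v]|.

Definition independent (H : digraph) (K : {set node H}) : Prop :=
  forall a : arc H, ~ (tail a \in K /\ head a \in K).

Definition kernel (H : digraph) (K : {set node H}) : Prop :=
  independent K /\
  forall v : node H, v \notin K -> exists a : arc H, tail a = v /\ head a \in K.

Section Induced.
Variables (H : digraph) (S : {set node H}).

Definition induced_node := {v : node H | v \in S}.
Definition induced_arc := {a : arc H | (tail a \in S) && (head a \in S)}.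

Definition induced_tail (a : induced_arc) : induced_node :=
  exist _ (tail (val a)) (proj1 (andP (valP a))).
Definition induced_head (a : induced_arc) : induced_node :=
  exist _ (head (val a)) (proj2 (andP (valP a))).

Definition induced : digraph := Digraph induced_tail induced_head.
End Induced.

Definition kernel_perfect (H : digraph) : Prop :=
  forall S : {set node H}, exists K : {set node (induced S)}, kernel K.

Section Galvin.
Variables (G : mgraph) (U D : {set vertex G}) (k : nat) (phi : edge G -> 'I_k).

(* The edge l of L(G) is oriented from e to f. *)
Definition galvin_orients (l : edge (line_graph G)) (e f : edge G) : bool :=
  (ends l == [set e; f]) &&
  ((incidence l \in D) && (phi f < phi e)
   || (incidence l \in U) && (phi e < phi f)).

Definition galvin_arc :=
  {a : edge (line_graph G) * (edge G * edge G) | galvin_orients a.1 a.2.1 a.2.2}.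

Definition galvin_orientation : digraph :=
  @Digraph (edge G) galvin_arc (fun a => (val a).2.1) (fun a => (val a).2.2).

(* Each edge of L(G) gives rise to exactly one arc. *)
Lemma galvin_orients_unique (l : edge (line_graph G)) :
  U :|: D = setT -> [disjoint U & D] -> is_edge_colouring phi ->
  exists! ef : edge G * edge G, galvin_orients l ef.1 ef.2.
Proof.
move=> UD dis col.
have /cards2P[e [f [ef lE]]] : #|line_ends l| == 2 by rewrite card_line_ends.
have inc g : g \in line_ends l -> incidence l \in ends g.
  by move=> gl; case/andP: (valP l) => _ /forall_inP; apply.
have ne : phi e != phi f.
  move/forallP/(_ e)/forallP/(_ f)/implyP: col; apply; rewrite ef /=.
  by apply/set0Pn; exists (incidence l); rewrite inE !inc // lE !inE eqxx ?orbT.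
have xU : (incidence l \in U) = (incidence l \notin D).
  have := in_setT (incidence l); rewrite -UD inE.
  by have [xU _|_ /= ->//] := boolP (_ \in U); rewrite (disjointFr dis xU).
pose P a b := if incidence l \in D then phi b < phi a else phi a < phi b.
have oE a b : galvin_orients l a b = ([set e; f] == [set a; b]) && P a b.
  rewrite /galvin_orients /= lE xU /P; congr (_ && _).
  by case: (_ \in D); rewrite /= ?orbF.
have Pef : P f e = ~~ P e f.
  rewrite /P; move: ne; rewrite -val_eqE /= neq_ltn.
  by case: (_ \in D); case: ltngtP.
have two a b : [set e; f] == [set a; b] -> (a, b) = (e, f) \/ (a, b) = (f, e).
  move/eqP=> E; have := set21 e f; have := set22 e f; rewrite {1 2}E !inE.
  case/orP=> /eqP fE /orP[] /eqP eE; subst; rewrite ?eqxx in ef *; by [|left|right].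
have [Q|Q] := boolP (P e f).
  exists (e, f); split=> [|[a b]] /=; first by rewrite oE eqxx.
  by rewrite oE => /andP[/two[]// [-> ->]]; rewrite Pef Q.
exists (f, e); split=> [|[a b]] /=; first by rewrite oE Pef Q setUC eqxx.
by rewrite oE => /andP[/two[]// [-> ->]]; rewrite (negPf Q).
Qed.

Definition proper_galvin : Prop :=
  kernel_perfect galvin_orientation /\
  forall e : node galvin_orientation, outdegree e <= k - 1.
End Galvin.

Definition has_proper_galvin_orientation (G : mgraph) (k : nat) : Prop :=
  exists (U D : {set vertex G}) (phi : edge G -> 'I_k),
    [/\ U :|: D = setT, [disjoint U & D], is_edge_colouring phi
      & proper_galvin U D phi].

(* Main.v *)
Require Import Defs.
From mathcomp Require Import all_boot zify.

(* Besides the outdegree bound k - 1, only one consequence of kernel-perfectness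
   is needed: a triangle of K_n with one vertex x on one side of the partition
   and y, z on the other does not have phi(xy) < phi(yz) < phi(xz), since its
   edges would form a directed 3-cycle of L(K_n). Call an edge with both ends in
   D (in U) a DD-edge (UU-edge); the outdegree bound forces the DD-edges to have
   small colours and the UU-edges to have large ones.

   If n = 2h, with n - 1 colours 0, ..., 2h - 2, then DD-edges have colours at
   most h - 1 and UU-edges at least h - 1. Hence colour 0 matches U into D and
   colour 2h - 2 matches D into U, both perfectly; for u in U, the edge joining
   its two partners is a DD-edge, which has a colour strictly between.

   If n = 2m + 1, with n colours, then every vertex misses exactly one colour and
   every colour misses exactly one vertex. The extreme colours give
   | |D| - |U| | = 1, and reversing the colours allows |D| = m + 1. A colour
   above m + 1 has no DD-edge, so it matches U into D and misses a vertex of D.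
   Some u in U has its colour m + 1 edge towards D: otherwise the vertex of D
   missing colour 2m would have a DD-edge of colour m + 1, whose outdegree is too
   large. So the missing colour of u is at most m and the UU-edges at u have
   colours m - 1 or m, while one of colour m - 1 forces u to miss m. This leaves
   m = 2 and a short analysis of K_5. *)

Set Implicit Arguments.
Unset Strict Implicit.
Unset Printing Implicit Defensive.

(** * Symmetric Latin squares *)

Lemma set2_eqE (T : finType) (x y z : T) : [set x; y] = [set x; z] -> y = z.
Proof.
move=> E; have := set22 x y; rewrite E !inE => /orP[/eqP yx|/eqP//].
by have := set22 x z; rewrite -E yx !inE orbb => /eqP->.
Qed.

Lemma card_leqD1 (T : finType) (x : T) (A : {set T}) : #|A| <= #|A :\ x|.+1.
Proof. by rewrite (cardsD1 x A) -addn1 addnC leq_add2l leq_b1. Qed.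

Section SymmetricLatinSquare.
Variables (n : nat) (c : 'I_n -> 'I_n -> 'I_n).
Hypotheses (c_sym : forall x y, c x y = c y x) (c_inj : forall x, injective (c x)).

(** For fixed [j] this is the matching formed by the edges of colour [j]; its fixed points are the
    vertices with diagonal entry [j], which miss that colour. *)
Definition mate (j x : 'I_n) : 'I_n := invF (@c_inj x) j.

Lemma mateK j x : c x (mate j x) = j.
Proof. exact: f_invF. Qed.

Lemma mate_uniq j x y : c x y = j -> mate j x = y.
Proof. by move=> cxy; apply: (@c_inj x); rewrite mateK. Qed.

Lemma mate_invol j : involutive (mate j).
Proof. by move=> x; apply: mate_uniq; rewrite c_sym mateK. Qed.

Lemma mate_inj j : injective (mate j).
Proof. exact: can_inj (mate_invol j). Qed.

Lemma card_mate_cross (A : {set 'I_n}) j :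
  {in A, forall x, mate j x \notin A} -> #|A| <= #|~: A|.
Proof.
move=> out; rewrite -(card_imset _ (@mate_inj j)); apply: subset_leq_card.
by apply/subsetP=> _ /imsetP[x xA ->]; rewrite inE out.
Qed.

(** Injectivity and the cardinality bound make [mate j] a bijection from [A] onto [B], and it is its
    own inverse. *)
Lemma mate_cross_onto (A B : {set 'I_n}) j x :
  {in A, forall x, mate j x \in B} -> #|B| <= #|A| -> x \in B -> mate j x \in A.
Proof.
move=> out le_BA xB.
have sub : mate j @: A \subset B by apply/subsetP=> _ /imsetP[y yA ->]; exact: out.
have : mate j @: A == B by rewrite eqEcard sub card_imset //; exact: mate_inj.
by move/eqP=> defB; move: xB; rewrite -defB => /imsetP[y yA ->]; rewrite mate_invol.
Qed.

Lemma card_row_lt x (j : 'I_n) : #|[set z | c x z < j]| = j.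
Proof.
have -> : [set z | c x z < j] = c x @^-1: [set i : 'I_n | i < j].
  by apply/setP=> z; rewrite !inE.
rewrite on_card_preimset; last by apply: onW_bij; exact: injF_bij.
rewrite cardsE cardE -(size_map val) -[RHS](size_iota 0) ; apply/eqP.
rewrite -(uniq_size_uniq (iota_uniq _ _)) ?(map_inj_uniq val_inj) ?enum_uniq // => i.
rewrite mem_iota; apply/idP/mapP => [/= lt_ij|[k]].
  by exists (Ordinal (ltn_trans lt_ij (ltn_ord j))) => //; rewrite mem_enum.
by rewrite mem_enum => + ->.
Qed.

(** A row is a permutation, so exactly [j] of its entries lie below [j], one of them possibly on the
    diagonal. *)
Lemma card_row_lt_off x (j : 'I_n) : #|[set z | (z != x) && (c x z < j)]| + (c x x < j) = j.
Proof.
rewrite -[RHS](card_row_lt x) (cardsD1 x [set z | c x z < j]) inE addnC; congr (_ + _).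
by apply: eq_card => z; rewrite !inE.
Qed.

Lemma mate_fixed j : odd n -> exists x, mate j x = x.
Proof.
move=> odd_n; suff /existsP[x /eqP]: [exists x, mate j x == x] by exists x.
move: odd_n; apply: contraTT => /existsPn nofix.
(* [L] takes the smaller element of each matched pair; without fixed points the matching exchanges
   it with its complement, so [n] is even. *)
pose L := [set x : 'I_n | x < mate j x].
have defL : mate j @: L = ~: L.
  apply/setP=> y; rewrite inE; apply/imsetP/idP => [[x xL ->]|yL].
    by move: xL; rewrite !inE mate_invol; lia.
  exists (mate j y); last by rewrite mate_invol.
  by move: yL (nofix y); rewrite !inE mate_invol -val_eqE /=; lia.
have := cardsC L; rewrite -defL card_imset ?card_ord; last exact: mate_inj.
by move=> <-; rewrite addnn odd_double.
Qed.

Lemma diag_onto j : odd n -> exists x, c x x = j.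
Proof. by move=> odd_n; have [x fx] := mate_fixed j odd_n; exists x; rewrite -{2}fx mateK. Qed.

(** Every colour is missed by some vertex, and a surjection of a finite set onto itself is
    injective. *)
Lemma diag_inj : odd n -> injective (fun x => c x x).
Proof.
move=> odd_n; have surj j : exists x, c x x == j by have [x <-] := diag_onto j odd_n; exists x.
pose r j := xchoose (surj j).
have rK : cancel r (fun x => c x x) by move=> j; apply/eqP; exact: (xchooseP (surj j)).
have [s rK' sK] := injF_bij (can_inj rK).
by apply: (can_inj (g := r)) => x; rewrite -(sK x) rK.
Qed.
End SymmetricLatinSquare.

Lemma card_row_gt_off n (c : 'I_n -> 'I_n -> 'I_n) (c_inj : forall x, injective (c x))
    x (j : 'I_n) :
  #|[set z | (z != x) && (j < c x z)]| + (j < c x x) = n.-1 - j.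
Proof.
have rev_lt (i : 'I_n) : (rev_ord i < rev_ord j) = (j < i).
  by have := ltn_ord i; have := ltn_ord j; rewrite /=; lia.
have rev_inj y : injective (fun z => rev_ord (c y z)).
  by apply: inj_comp; [exact: rev_ord_inj | exact: c_inj].
have := card_row_lt_off rev_inj x (rev_ord j); rewrite rev_lt.
under eq_finset => z do rewrite rev_lt.
by move=> ->; rewrite /=; lia.
Qed.

(* Writing on the diagonal a colour that the vertex misses turns an edge-colouring
   of K_n with at most n colours into a symmetric Latin square. The fields
   [square_down] and [square_up] are the outdegree bound of an edge inside D and
   inside its complement, where the diagonal terms correct the count of the
   smaller (larger) entries of a row; [square_triangle] says that no triangle of
   K_n is a directed 3-cycle of L(K_n). *)
Record galvin_square (n k : nat) (D : {set 'I_n}) (c : 'I_n -> 'I_n -> 'I_n) : Prop :=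
  GalvinSquare {
    square_sym : forall x y, c x y = c y x;
    square_inj : forall x, injective (c x);
    square_down : forall x y, x \in D -> y \in D -> x != y ->
      (c x y).*2 <= k.-1 + (c x x < c x y) + (c y y < c x y);
    square_up : forall x y, x \notin D -> y \notin D -> x != y ->
      (n.-1 - c x y).*2 <= k.-1 + (c x y < c x x) + (c x y < c y y);
    square_triangle : forall x y z, y != z -> (y \in D) = (z \in D) ->
      (x \in D) != (y \in D) -> ~~ (c x y < c y z < c x z) }.

(** Reversal exchanges the two outdegree bounds and reads the chain of colours around a triangle
    backwards, with [y] and [z] swapped. *)
Lemma galvin_square_rev n k D c :
  @galvin_square n k D c -> galvin_square k (~: D) (fun x y => rev_ord (c x y)).
Proof.
case=> sym inj down up tri; split => [x y|x|x y|x y|x y z yz].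
- by rewrite sym.
- by apply: inj_comp; [exact: rev_ord_inj | exact: inj].
- rewrite !inE /= => xD yD xy; have := up x y xD yD xy.
  by have := ltn_ord (c x y); have := ltn_ord (c x x); have := ltn_ord (c y y); lia.
- rewrite !inE !negbK /= => xD yD xy; have := down x y xD yD xy.
  by have := ltn_ord (c x y); have := ltn_ord (c x x); have := ltn_ord (c y y); lia.
rewrite !inE => /negb_inj Dyz; rewrite (inj_eq negb_inj) => Dxy /=.
have := tri x z y; rewrite eq_sym yz (sym z y) -Dyz => /(_ isT erefl Dxy).
by have := ltn_ord (c x y); have := ltn_ord (c y z); have := ltn_ord (c x z); lia.
Qed.

(** * Even order *)

Lemma no_even_square h (D : {set 'I_h.*2}) c :
  1 < h -> galvin_square h.*2.-1 D c -> (forall x, c x x = h.*2.-1 :> nat) -> False.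
Proof.
move=> h1 [sym inj down up tri] diag.
(* The diagonal holds the extra value 2h - 1, so the extreme colours of edges are 0 and 2h - 2. *)
have lt0 : 0 < h.*2 by lia.
have lt1 : h.*2.-2 < h.*2 by lia.
pose lo := Ordinal lt0; pose hi := Ordinal lt1.
have loU : {in ~: D, forall x, mate inj lo x \in D}.
  move=> x; rewrite inE => xU; apply/negPn/negP => yU.
  have cxy := mateK inj lo x; have [yx|ne] := eqVneq x (mate inj lo x).
    by move: (diag x); rewrite {2}yx cxy /=; lia.
  by have := up _ _ xU yU ne; rewrite cxy !diag /=; lia.
have hiD : {in D, forall x, mate inj hi x \in ~: D}.
  move=> x xD; rewrite inE; apply/negP => yD.
  have cxy := mateK inj hi x; have [yx|ne] := eqVneq x (mate inj hi x).
    by move: (diag x); rewrite {2}yx cxy /=; lia.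
  by have := down _ _ xD yD ne; rewrite cxy !diag /=; lia.
have leUD : #|~: D| <= #|D|.
  rewrite -{2}(setCK D); apply: (@card_mate_cross _ _ sym inj _ lo) => x xU.
  by rewrite inE loU.
have leDU : #|D| <= #|~: D|.
  by apply: (@card_mate_cross _ _ sym inj _ hi) => x /hiD; rewrite inE.
have [u uU] : exists u, u \in ~: D.
  by apply/card_gt0P; have := cardsC D; rewrite card_ord; lia.
have aD := loU _ uU.
have bD : mate inj hi u \in D by exact: (mate_cross_onto sym hiD leUD uU).
have ca := mateK inj lo u; have cb := mateK inj hi u.
move: (mate inj lo u) (mate inj hi u) aD bD ca cb => a b aD bD ca cb.
have ab : a != b by apply/eqP=> eq_ab; move: cb; rewrite -eq_ab ca => /(congr1 val) /=; lia.
have := tri u a b ab; rewrite aD bD; move: uU; rewrite inE => /negPf-> /(_ erefl isT).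
rewrite ca cb /= => /negP; apply.
have := down _ _ aD bD ab; rewrite !diag => cab.
(* By the sizes of the two sides, colour 0 also leads from [D] back to [~: D], so it cannot join [a]
   to [b]. *)
have : c a b != lo.
  apply/eqP=> cab0; have := mate_cross_onto sym loU leDU aD.
  by rewrite (mate_uniq inj cab0) inE bD.
by have := ltn_ord (c a b); rewrite -val_eqE /=; lia.
Qed.

(** * Odd order *)

(** A UU-edge of colour 0 would need 4m <= 2m + 2. So colour 0 matches [~: D] into [D], except for
    the one vertex [f] that misses it. *)
Lemma odd_square_balanced m (D : {set 'I_m.*2.+1}) c :
  1 < m -> galvin_square m.*2.+1 D c -> #|~: D| <= #|D|.+1.
Proof.
move=> m1 [sym inj down up tri].
have odd_n : odd m.*2.+1 by rewrite /= odd_double.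
have [f fK] := diag_onto sym inj ord0 odd_n.
have : #|~: D :\ f| <= #|D|.
  rewrite -(card_imset _ (@mate_inj _ _ sym inj ord0)); apply: subset_leq_card.
  apply/subsetP=> _ /imsetP[x + ->]; rewrite !inE => /andP[xf xU].
  apply/negPn/negP => yU; have cxy := mateK inj ord0 x.
  have [yx|ne] := eqVneq x (mate inj ord0 x).
    have /(diag_inj sym inj odd_n) eq_xf : c x x = c f f by rewrite {2}yx cxy.
    by rewrite eq_xf eqxx in xf.
  by have := up _ _ xU yU ne; rewrite cxy /=; lia.
by move=> le; apply: leq_trans (card_leqD1 f _) _; rewrite ltnS.
Qed.

Lemma no_odd_square_unbalanced m (D : {set 'I_m.*2.+1}) c :
  1 < m -> galvin_square m.*2.+1 D c -> #|D| = m.+1 -> False.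
Proof.
move=> m1 [sym inj down up tri] cardD.
have odd_n : odd m.*2.+1 by rewrite /= odd_double.
have dinj := diag_inj sym inj odd_n.
have cardU : #|~: D| = m by have := cardsC D; rewrite card_ord; lia.
have high (j : 'I_m.*2.+1) : m.+1 < j -> {in ~: D, forall x, mate inj j x \in D}.
  move=> lt_j x xU; have [f fj] := diag_onto sym inj j odd_n.
  suff : mate inj j x \in D :\ f by rewrite !inE => /andP[].
  (* A DD-edge cannot have colour [j], so [D :\ f] is sent into [~: D]; the sizes make this onto,
     and the matching leads back. *)
  apply: (mate_cross_onto sym (A := D :\ f) (B := ~: D)) => //; last first.
    by rewrite cardU -ltnS -cardD card_leqD1.
  move=> y; rewrite !inE => /andP[yf yD]; apply/negP=> zD.
  have cyz := mateK inj j y; have [zy|ne] := eqVneq y (mate inj j y).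
    have /dinj eq_yf : c y y = c f f by rewrite {2}zy cyz.
    by rewrite eq_yf eqxx in yf.
  by have := down _ _ yD zD ne; rewrite cyz; lia.
(* The case [x = y] bounds the colour that [x] misses. *)
have leU x y : x \notin D -> y \notin D -> c x y <= m.+1.
  move=> xU yU; rewrite leqNgt; apply/negP=> lt_c.
  have := high _ lt_c x; rewrite inE xU (mate_uniq inj (erefl (c x y))).
  by move=> /(_ isT); rewrite (negPf yU).
have [a aE] := diag_onto sym inj ord_max odd_n.
have aD : a \in D by apply/negPn/negP=> aU; have := leU a a aU aU; rewrite aE /=; lia.
have lt_m1 : m.+1 < m.*2.+1 by lia.
pose top := Ordinal lt_m1.
have [u] : exists2 u, u \in ~: D & mate inj top u \in D.
  apply/exists_inP; apply: contraT => /exists_inPn closedU.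
  have bD : mate inj top a \in D.
    apply/negPn/negP; rewrite -in_setC => /closedU.
    by rewrite (mate_invol sym) aD.
  have cab := mateK inj top a; have [ba|ne] := eqVneq a (mate inj top a).
    by have := congr1 val aE; rewrite {2}ba cab /=; lia.
  (* Since [a] misses 2m, its diagonal term vanishes, and 2(m + 1) <= 2m + 1 is false. *)
  by have := down _ _ aD bD ne; rewrite cab aE /=; lia.
rewrite inE => uU utop.
have leu y : y \notin D -> c u y <= m.
  move=> yU; have := leU u y uU yU; suff : c u y != top by rewrite -val_eqE /=; lia.
  by apply/eqP=> /(mate_uniq inj) uy; rewrite -uy utop in yU.
have geu y : y \notin D -> u != y -> m.-1 <= c u y.
  by move=> yU ne; have := up _ _ uU yU ne; lia.
have diagu y : y \notin D -> u != y -> c u y = m.-1 :> nat -> c u u = m :> nat.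
  by move=> yU ne cE; have := up _ _ uU yU ne; have := leu u uU; lia.
have row_neq x y z : y != z -> c x y != c x z :> nat.
  by apply: contraNneq => /val_inj /inj ->.
have [b bU ub] : exists2 b, b \notin D & u != b.
  have /card_gt0P[b] : 0 < #|~: D :\ u|.
    by rewrite -ltnS (leq_trans _ (card_leqD1 _ _)) // cardU.
  by rewrite !inE eq_sym => /andP[bu bU]; exists b.
have m2 : m = 2.
  apply/eqP; rewrite eqn_leq m1 andbT leqNgt; apply/negP=> m3.
  (* With a third vertex [d], the edges ub and ud take the colours m - 1 and m; but m - 1 forces [u]
     to miss m. *)
  have /card_gt0P[d] : 0 < #|~: D :\ u :\ b|.
    have := card_leqD1 u (~: D); rewrite cardU => /(leq_trans m3); rewrite ltnS => m2.
    exact: leq_trans m2 (card_leqD1 b _).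
  rewrite !inE eq_sym (eq_sym d) => /and3P[bd ud dU].
  have val_u y : y \notin D -> u != y -> c u y = m.-1 :> nat \/ c u y = m :> nat.
    by move=> yU ne; have := leu y yU; have := geu y yU ne; clear -m1; lia.
  have := row_neq u _ _ bd; have := row_neq u _ _ ub; have := row_neq u _ _ ud.
  have [eb|eb] := val_u b bU ub; have [ed|ed] := val_u d dU ud; rewrite eb ed ?eqxx //.
    by rewrite (diagu b) ?eqxx.
  by rewrite (diagu d) ?eqxx.
(* In K_5, [~: D] is {u, b}, the colours are 0 to 4, and ub has colour 1 or 2. *)
subst m.
have /eqP UE : [set u; b] == ~: D.
  rewrite eqEcard cards2 ub cardU leqnn andbT.
  by apply/subsetP=> y; rewrite !inE => /orP[] /eqP ->.
have toD x y j : x \notin D -> c x y = j -> c x u != j :> nat -> c x b != j :> nat -> y \in D.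
  move=> xU <- nu nb; apply: contraT; rewrite -in_setC -UE !inE.
  by case/orP=> /eqP yE; subst y; rewrite eqxx in nu nb.
have side x : x \in D -> ~~ (c x u < c u b < c x b) /\ ~~ (c x b < c u b < c x u).
  move=> xD; split; last rewrite (sym u); apply: tri; rewrite ?xD ?(negPf uU) ?(negPf bU) //.
  by rewrite eq_sym.
have diag_neq x y : x != y -> c x x != c y y :> nat.
  by apply: contraNneq => /val_inj /dinj ->.
have Dneq x : x \in D -> (x != u) /\ (x != b).
  by move=> xD; split; [apply: contraNneq uU | apply: contraNneq bU] => <-.
have cross x : x \in D ->
    (c x u != c x b :> nat) /\ (c x u != c u b :> nat) /\ (c x b != c u b :> nat).
  move=> /Dneq[xu xb]; split; first exact: row_neq; split.
    by rewrite sym row_neq.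
  by rewrite (sym x) (sym u) row_neq.
have cross_diag x : x \in D -> (c u u != c x u :> nat) /\ (c b b != c x b :> nat).
  by move=> /Dneq[xu xb]; rewrite !(sym x) !row_neq // eq_sym.
have getD x v : x \notin D -> v < 5 -> c x u != v :> nat -> c x b != v :> nat ->
    exists2 y, y \in D & c y x = v :> nat.
  move=> xU lt_v xu xb; exists (mate inj (Ordinal lt_v) x); last by rewrite sym mateK.
  by apply: toD (mateK inj (Ordinal lt_v) x) _ _.
have c_ub := geu b bU ub; have c_ub' := leu b bU; have c_uu := leu u uU.
have nu := row_neq u _ _ ub.
have [c1|c2] : c u b = 1 :> nat \/ c u b = 2 :> nat by clear -c_ub c_ub'; lia.
  (* Colour 0 at [u] leads to some [x] in [D]; the edge xb can have neither 0 nor 1 and, by the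
     triangle xub, nothing larger. *)
  have d2 := diagu b bU ub c1; rewrite c1 in side cross.
  have [||x xD cx] := getD u 0 uU isT _ _; rewrite ?d2 ?c1 //.
  by have := cross x xD; have := side x xD; rewrite cx; clear; lia.
rewrite c2 in side cross nu.
have c_bb := leU b b bU bU; have nb : c b b != 2 :> nat 
  by have := row_neq b b u; rewrite (sym b u) c2 (eq_sym b); apply.
have nub := diag_neq _ _ ub.
have [e3|ne3] := eqVneq (c b b : nat) 3.
  (* Colours 0 and 1 at [b] lead to [x] and [y] in [D]. The triangles give xu and yu the colours 1
     and 0, which leaves [u] no colour to miss. *)
  have [||x xD cx] := getD b 0 bU isT _ _; rewrite ?(sym b u) ?c2 ?e3 //.
  have [||y yD cy] := getD b 1 bU isT _ _; rewrite ?(sym b u) ?c2 ?e3 //.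
  have cxu : c x u = 1 :> nat.
    by have := cross x xD; have := side x xD; rewrite cx; clear; lia.
  have cyu : c y u = 0 :> nat.
    by have := cross y yD; have := side y yD; rewrite cy; clear; lia.
  have [nx _] := cross_diag x xD; have [ny _] := cross_diag y yD.
  by rewrite cxu in nx; rewrite cyu in ny; clear -nx ny nu c_uu; lia.
(* Now [u] and [b] miss 0 and 1 in some order. If zu has a colour above 2, so does zb by the
   triangle; they use up 3 and 4, and [z] can only miss 2. *)
have diag2 z : z \in D -> 2 < c z u -> c z z = 2 :> nat.
  move=> zD lt_zu; have [zu zb] := Dneq z zD.
  have lt_zb : 2 < c z b by have := cross z zD; have := side z zD; clear -lt_zu; lia.
  have [n1 _] := cross z zD; have n2 := row_neq z _ _ zu; have n3 := row_neq z _ _ zb.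
  have n4 := diag_neq _ _ zu; have n5 := diag_neq _ _ zb.
  have := ltn_ord (c z u); have := ltn_ord (c z b); have := ltn_ord (c z z).
  have [lt_u lt_b] : c u u < 2 /\ c b b < 2 by clear -nu c_uu c_bb ne3 nb; lia.
  clear -n1 n2 n3 n4 n5 lt_zu lt_zb lt_u lt_b nub.
  move: (c z u : nat) (c z b : nat) (c z z : nat) (c u u : nat) (c b b : nat)
    n1 n2 n3 n4 n5 lt_zu lt_zb lt_u lt_b nub => p q r s t.
  case: s => [|[|//]]; case: t => [|[|//]] //; lia.
(* Colours 3 and 4 at [u] lead to two vertices of [D] that would both miss 2. *)
have [||x xD cx] := getD u 3 uU isT _ _; rewrite ?c2 //; first by clear -c_uu; lia.
have [||y yD cy] := getD u 4 uU isT _ _; rewrite ?c2 //; first by clear -c_uu; lia.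
have xy : x != y by apply/eqP=> exy; rewrite exy cy in cx.
by have := diag_neq _ _ xy; rewrite !diag2 ?cx ?cy.
Qed.

Lemma no_odd_square m (D : {set 'I_m.*2.+1}) c : 1 < m -> ~ galvin_square m.*2.+1 D c.
Proof.
move=> m1 sq; have sq' := galvin_square_rev sq.
have := odd_square_balanced m1 sq; have := odd_square_balanced m1 sq'; rewrite setCK => leDU leUD.
have cardDU : #|D| + #|~: D| = m.*2.+1 by rewrite cardsC card_ord.
have [cardD|cardU] : #|D| = m.+1 \/ #|~: D| = m.+1.
  by move: #|D| #|~: D| leDU leUD cardDU => p q; clear; lia.
- exact: no_odd_square_unbalanced m1 sq cardD.
- exact: no_odd_square_unbalanced m1 sq' cardU.
Qed.

(** * Galvin orientations and 3-cycles *)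

Definition has_arc (H : digraph) (u v : node H) : Prop :=
  exists a : Defs.arc H, tail a = u /\ Defs.head a = v.

(** Transports kernels from the subtype of nodes of an induced subdigraph to subsets of the nodes of
    [H]. *)
Lemma kernel_perfect_kernel (H : digraph) (S : {set node H}) :
  kernel_perfect H -> exists K : {set node H},
    [/\ K \subset S, forall u v, u \in K -> v \in K -> ~ has_arc u v
      & forall v, v \in S -> v \notin K -> exists2 w, w \in K & has_arc v w].
Proof.
move=> /(_ S)[K [indep absorb]]; exists [set val w | w in K]; split.
- by apply/subsetP=> _ /imsetP[w _ ->]; exact: valP.
- move=> _ _ /imsetP[u uK ->] /imsetP[v vK ->] [a [ta ha]].
  have aS : (tail a \in S) && (Defs.head a \in S) by rewrite ta ha; apply/andP; split; exact: valP.
  pose b : Defs.arc (induced S) := exist (fun a => (tail a \in S) && (Defs.head a \in S)) a aS.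
  have tb : tail b = u by apply: val_inj.
  have hb : Defs.head b = v by apply: val_inj.
  by apply: (indep b); rewrite tb hb.
move=> v vS vK; have [|a [ta ha]] := absorb (exist _ v vS).
  by apply: contra vK => vK; apply/imsetP; exists (exist _ v vS).
exists (val (Defs.head a)); first exact: imset_f.
by exists (val a); split => //; rewrite -[RHS]/(val (exist (fun v => v \in S) v vS)) -ta.
Qed.

(** In the subdigraph induced by a directed 3-cycle, an independent set has at most one node, and a
    single node absorbs only its predecessor. *)
Lemma kernel_perfect_no_3cycle (H : digraph) (e f g : node H) :
  kernel_perfect H -> has_arc e f -> has_arc f g -> has_arc g e ->
  ~ has_arc f e -> ~ has_arc g f -> ~ has_arc e g -> False.
Proof.
move=> /(@kernel_perfect_kernel _ [set e; f; g])[K [/subsetP subK indep absorb]] ef fg ge fe gf eg.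
have absorb_cases v : v \in [set e; f; g] -> v \notin K ->
    [\/ e \in K /\ has_arc v e, f \in K /\ has_arc v f | g \in K /\ has_arc v g].
  move=> vS vK; have [w wK vw] := absorb v vS vK.
  have := subK w wK; rewrite !inE => /orP[/orP[]|] /eqP def_w; subst w.
  - by constructor 1.
  - by constructor 2.
  - by constructor 3.
have excl u v : has_arc u v -> u \in K -> v \notin K.
  by move=> uv uK; apply/negP=> vK; exact: indep uK vK uv.
have [eK|eK] := boolP (e \in K).
  have fK := excl e f ef eK; have gK : g \notin K by apply/negP=> /(excl g e ge); rewrite eK.
  by case: (absorb_cases f); rewrite ?inE ?eqxx ?orbT // => -[]; rewrite ?(negPf fK) ?(negPf gK).
have [fK|fK] := boolP (f \in K).
  have gK := excl f g fg fK.
  by case: (absorb_cases g); rewrite ?inE ?eqxx ?orbT // => -[]; rewrite ?(negPf eK) ?(negPf gK).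
by case: (absorb_cases e); rewrite ?inE ?eqxx ?orbT // => -[]; rewrite ?(negPf eK) ?(negPf fK).
Qed.

Section GalvinArcs.
Variables (G : mgraph) (U D : {set vertex G}) (k : nat) (phi : edge G -> 'I_k).

Definition leaves_at (x : vertex G) (i j : 'I_k) : bool :=
  (x \in D) && (j < i) || (x \in U) && (i < j).

Lemma galvin_arc_exists (e f : edge G) x :
  e != f -> x \in ends e -> x \in ends f -> leaves_at x (phi e) (phi f) ->
  exists a : galvin_arc U D phi,
    [/\ incidence (val a).1 = x, (val a).2.1 = e & (val a).2.2 = f].
Proof.
move=> ef xe xf out.
have lP : (#|[set e; f]| == 2) && [forall g in [set e; f], x \in ends g].
  by rewrite cards2 ef; apply/forall_inP=> g; rewrite !inE => /orP[] /eqP->.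
pose l : edge (line_graph G) :=
  exist (fun p : {set edge G} * vertex G => (#|p.1| == 2) && [forall g in p.1, p.2 \in ends g])
    ([set e; f], x) lP.
have aP : galvin_orients U D phi l e f by rewrite /galvin_orients /= /line_ends eqxx.
by exists (exist (fun a : edge (line_graph G) * (edge G * edge G) =>
  galvin_orients U D phi a.1 a.2.1 a.2.2) (l, (e, f)) aP).
Qed.

Lemma has_galvin_arcP (e f : node (galvin_orientation U D phi)) :
  has_arc e f -> exists x, [/\ x \in ends e, x \in ends f & leaves_at x (phi e) (phi f)].
Proof.
case=> -[[l [e' f']] aP] /= [def_e def_f]; move: aP; rewrite /galvin_orients /= def_e def_f.
case/andP=> /eqP lE out; exists (incidence l).
have inc g : g \in line_ends l -> incidence l \in ends g.
  by move=> gl; case/andP: (valP l) => _ /forall_inP; apply.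
by split; rewrite ?inc // lE !inE eqxx ?orbT.
Qed.
End GalvinArcs.

(** * Edge-colourings of complete graphs *)

Section CompleteGraph.
Variable n : nat.
Implicit Types x y z : 'I_n.

Lemma complete_edgeP (e : edge (complete n)) : exists x y, x != y /\ ends e = [set x; y].
Proof. by have /cards2P := valP e. Qed.

Lemma complete_edge_exists x y : x != y -> exists e : edge (complete n), ends e = [set x; y].
Proof.
move=> xy; have eP : #|[set x; y]| == 2 by rewrite cards2 xy.
by exists (exist (fun e : {set 'I_n} => #|e| == 2) [set x; y] eP).
Qed.

Lemma complete_edge_inj (e f : edge (complete n)) : ends e = ends f -> e = f.
Proof. exact: val_inj. Qed.

Lemma complete_colourable k (g : 'I_n -> 'I_n -> nat) :
  (forall x y, g x y = g y x) -> (forall x y, x != y -> g x y < k) ->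
  (forall x y z, x != y -> x != z -> g x y = g x z -> y = z) ->
  edge_colourable (complete n) k.
Proof.
move=> g_sym g_lt g_inj.
(* The colour is specified for every listing of the two ends; symmetry of [g] makes this
   consistent. *)
have [e|phi phiE] := @fin_all_exists _ (fun _ => 'I_k)
    (fun (e : edge (complete n)) j => forall x y, ends e = [set x; y] -> j = g x y :> nat).
  have [x [y [xy eE]]] := complete_edgeP e; exists (Ordinal (g_lt x y xy)) => x' y'.
  rewrite eE => E; have := set21 x' y'; rewrite -E !inE /= => /orP[]/eqP def_x; subst x'.
    by rewrite (set2_eqE E).
  by rewrite g_sym; congr g; apply: (set2_eqE (x := y)); rewrite -E setUC.
apply/existsP; exists [ffun e => phi e]; apply/forallP=> e; apply/forallP=> f.
apply/implyP=> /andP[ef /set0Pn[x]]; rewrite !ffunE inE => /andP[xe xf].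
have other (h : edge (complete n)) : x \in ends h -> exists2 y, x != y & ends h = [set x; y].
  have [a [b [ab ->]]] := complete_edgeP h; rewrite !inE => /orP[]/eqP->; first by exists b.
  by exists a; rewrite 1?eq_sym // setUC.
have [y xy eE] := other e xe; have [z xz fE] := other f xf.
apply: contraNneq ef => /(congr1 val) /=; rewrite (phiE e x y) // (phiE f x z) // => /g_inj yz.
by apply/eqP/complete_edge_inj; rewrite eE fE yz.
Qed.
End CompleteGraph.

(** * Upper bounds on the chromatic index of K_n *)

Lemma chromatic_index_min (G : mgraph) k : edge_colourable G k -> chromatic_index G <= k.
Proof. by rewrite /chromatic_index; case: ex_minnP => m _ le_m /le_m. Qed.

Lemma chromatic_index_odd m : chromatic_index (complete m.*2.+1) <= m.*2.+1.
Proof.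
apply: chromatic_index_min; apply: (@complete_colourable _ _ (fun x y => (x + y) %% m.*2.+1)).
- by move=> x y; rewrite addnC.
- by move=> x y _; rewrite ltn_mod.
move=> x y z _ _ /eqP; rewrite eqn_modDl !modn_small // => /eqP; exact: val_inj.
Qed.

Lemma modn_lt_double a d : a < d.*2 -> a %% d = if a < d then a else a - d.
Proof.
move=> lt_a; case: ltnP => [lt_ad|le_da]; first exact: modn_small.
by rewrite -{1}(subnK le_da) modnDr modn_small //; lia.
Qed.

(* The edge from x to the last vertex takes 2x, the colour that x misses in [x + y mod (n - 1)]. *)
Lemma chromatic_index_even m : 0 < m -> chromatic_index (complete m.*2) <= m.*2.-1.
Proof.
case: m => // m _; rewrite doubleS /=.
pose N := m.*2.+1; pose s (x y : nat) := if x == N then y.*2 else if y == N then x.*2 else x + y.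
apply: chromatic_index_min; apply: (@complete_colourable _ _ (fun x y => s x y %% N)).
- by move=> x y; congr (_ %% _); rewrite /s; case: (x =P N :> nat); case: (y =P N :> nat); lia.
- by move=> x y _; rewrite ltn_mod.
have s_lt x y : x < N.+1 -> y < N.+1 -> x != y -> s x y < N.*2.
  by move=> xN yN xy; rewrite /s; case: (x =P N); case: (y =P N); lia.
move=> x y z xy xz.
rewrite !modn_lt_double ?s_lt ?ltn_ord // => E; apply: val_inj.
have := ltn_ord x; have := ltn_ord y; have := ltn_ord z.
move: E xy xz; rewrite -!val_eqE /= /s /N.
move: (x : nat) (y : nat) (z : nat) => {}x {}y {}z.
by case: (x =P m.*2.+1); case: (y =P m.*2.+1); case: (z =P m.*2.+1); do 2?case: ifP; lia.
Qed.

(** * Outdegrees and triangles in L(K_n) *)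

Lemma outdegree_galvin (G : mgraph) (U D : {set vertex G}) k (phi : edge G -> 'I_k)
    (e : node (galvin_orientation U D phi)) :
  #|[set p : vertex G * edge G | [&& e != p.2, p.1 \in ends e, p.1 \in ends p.2
       & leaves_at U D p.1 (phi e) (phi p.2)]]| <= outdegree e.
Proof.
pose F (a : Defs.arc (galvin_orientation U D phi)) := (incidence (val a).1, (val a).2.2).
apply: leq_trans (leq_imset_card F _); apply: subset_leq_card; apply/subsetP=> -[x f].
rewrite inE /= => /and4P[ef xe xf out].
have [a [ax ae af]] := galvin_arc_exists ef xe xf out.
by apply/imsetP; exists a; rewrite ?inE /F ?ax ?af //; apply/eqP.
Qed.

Section CompleteOutdegree.
Variables (n k : nat) (U D : {set 'I_n}) (phi : edge (complete n) -> 'I_k).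

(** The default 0 is taken only for [x = y], when [[set x; y]] is not an edge. *)
Definition pair_colour (x y : 'I_n) : nat :=
  oapp (fun e : edge (complete n) => val (phi e)) 0 (insub [set x; y]).

Lemma pair_colourE (e : edge (complete n)) x y : ends e = [set x; y] -> pair_colour x y = phi e.
Proof. by move=> eE; rewrite /pair_colour -eE valK. Qed.

Lemma pair_colour_sym x y : pair_colour x y = pair_colour y x.
Proof. by rewrite /pair_colour setUC. Qed.

Lemma pair_colour_lt x y : x != y -> pair_colour x y < k.
Proof. by move=> /complete_edge_exists[e eE]; rewrite (pair_colourE eE). Qed.

Lemma pair_colour_inj x y z :
  is_edge_colouring phi -> x != y -> x != z -> pair_colour x y = pair_colour x z -> y = z.
Proof.
move=> col /complete_edge_exists[e eE] /complete_edge_exists[f fE].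
rewrite (pair_colourE eE) (pair_colourE fE) => /val_inj eq_ef.
apply: (@set2_eqE _ x); rewrite -eE -fE; suff -> : e = f by [].
apply/eqP; apply: contraT => ef.
move/forallP/(_ e)/forallP/(_ f)/implyP: col; rewrite ef eq_ef eqxx; apply.
by apply/set0Pn; exists x; rewrite inE eE fE !set21.
Qed.

Definition pair_leaves_at (x : 'I_n) (i j : nat) : bool :=
  (x \in D) && (j < i) || (x \in U) && (i < j).

Definition out_neighbours (x y : 'I_n) : {set 'I_n} :=
  [set z | (z != x) && pair_leaves_at x (pair_colour x y) (pair_colour x z)].

Lemma outdegree_complete (e : node (galvin_orientation (G := complete n) U D phi)) (x y : 'I_n) :
  x != y -> ends (e : edge (complete n)) = [set x; y] ->
  #|out_neighbours x y| + #|out_neighbours y x| <= outdegree e.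
Proof.
move=> xy eE; apply: leq_trans (outdegree_galvin e).
(* An out-arc through [v] to the edge vz is recorded as (v, {z}); the first coordinate keeps the
   arcs through [x] and through [y] apart. *)
pose other (p : 'I_n * edge (complete n)) := (p.1, (ends p.2 : {set 'I_n}) :\ p.1).
apply: leq_trans (leq_imset_card other _).
pose at_ (x z : 'I_n) := (x, [set z]).
have at_inj v : injective (at_ v) by move=> a b [] /set1_inj.
have reach (v w : 'I_n) : v != w -> ends (e : edge (complete n)) = [set v; w] ->
    at_ v @: out_neighbours v w \subset
    other @: [set p : 'I_n * edge (complete n) | [&& e != p.2, p.1 \in ends (e : edge (complete n)),
       p.1 \in ends p.2 & leaves_at (G := complete n) U D p.1 (phi e) (phi p.2)]].
  move=> vw vE; apply/subsetP=> _ /imsetP[z + ->]; rewrite inE => /andP[zv].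
  have vz : v != z by rewrite eq_sym.
  have [f fE] := complete_edge_exists vz; rewrite (pair_colourE vE) (pair_colourE fE) => out.
  apply/imsetP; exists (v, f); last first.
    rewrite /at_ (_ : [set z] = (ends f : {set 'I_n}) :\ v) // fE.
    by apply/setP=> i; rewrite !inE; have [->|] := eqVneq i v; rewrite /= ?(negPf vz).
  have xe : v \in ends (e : edge (complete n)) by rewrite vE set21.
  have xf : v \in ends f by rewrite fE set21.
  rewrite inE; apply/and4P; split => //.
  by apply: contraTneq out => /= <-; rewrite /pair_leaves_at !ltnn !andbF.
rewrite -(card_imset _ (at_inj x)) -(card_imset _ (at_inj y)) -cardsUI.
rewrite [X in _ + #|pred_of_set X|](_ : _ = set0) ?cards0 ?addn0.
  by apply: subset_leq_card; rewrite subUset !reach // 1?eq_sym // setUC.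
apply/setP=> p; rewrite !inE; apply/negP=> /andP[/imsetP[a _ ->] /imsetP[b _ [yx _]]].
by rewrite yx eqxx in xy.
Qed.

Lemma has_arc_complete (e f : node (galvin_orientation (G := complete n) U D phi)) (u v w : 'I_n) :
  v != u -> v != w -> u != w ->
  ends (e : edge (complete n)) = [set v; u] -> ends (f : edge (complete n)) = [set v; w] ->
  has_arc e f <-> pair_leaves_at v (pair_colour v u) (pair_colour v w).
Proof.
move=> vu vw uw eE fE; rewrite (pair_colourE eE) (pair_colourE fE); split.
  case/has_galvin_arcP=> x []; rewrite eE fE !inE.
  move=> /orP[]/eqP-> //; rewrite (negPf uw) orbF => /eqP uv; by rewrite uv eqxx in vu.
move=> out; have ef : (e : edge (complete n)) != f.
  by apply: contraTneq out => ->; rewrite /pair_leaves_at !ltnn !andbF.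
have ve : v \in ends (e : edge (complete n)) by rewrite eE set21.
have vf : v \in ends (f : edge (complete n)) by rewrite fE set21.
have [a [_ ae af]] := galvin_arc_exists (G := complete n) ef ve vf out.
by exists a.
Qed.

(** If x is in [D] and y, z are in [U], the arcs run xy to yz at y, yz to xz at z, and xz to xy at
    x; with the sides exchanged, the cycle is reversed. *)
Lemma no_monotone_triangle x y z :
  U = ~: D -> kernel_perfect (galvin_orientation (G := complete n) U D phi) ->
  x != y -> x != z -> y != z -> (y \in D) = (z \in D) -> (x \in D) != (y \in D) ->
  ~~ (pair_colour x y < pair_colour y z < pair_colour x z).
Proof.
move=> UE kp xy xz yz Dyz Dxy; apply/negP=> /andP[lt1 lt2].
have lt3 := ltn_trans lt1 lt2.
have inU v : (v \in U) = (v \notin D) by rewrite UE inE.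
have [e eE] := complete_edge_exists xy; have [f fE] := complete_edge_exists yz.
have [g gE] := complete_edge_exists xz.
have eE' : ends e = [set y; x] by rewrite setUC.
have fE' : ends f = [set z; y] by rewrite setUC.
have gE' : ends g = [set z; x] by rewrite setUC.
have [yx zx zy] : [/\ y != x, z != x & z != y] by rewrite ![_ == x]eq_sym (eq_sym z y).
have ef := has_arc_complete yx yz xz eE' fE; have fe := has_arc_complete yz yx zx fE eE'.
have fg := has_arc_complete zy zx yx fE' gE'; have gf := has_arc_complete zx zy xy gE' fE'.
have ge := has_arc_complete xz xy zy gE eE; have eg := has_arc_complete xy xz yz eE gE.
move: ef fe fg gf ge eg; rewrite /pair_leaves_at !inU -Dyz.
rewrite !(pair_colour_sym y x) !(pair_colour_sym z _) lt1 lt2 lt3.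
rewrite [_ < pair_colour x y]ltnNge (ltnW lt1) [_ < pair_colour y z]ltnNge (ltnW lt2).
rewrite [pair_colour x z < _]ltnNge (ltnW lt3).
have no3 := @kernel_perfect_no_3cycle (galvin_orientation (G := complete n) U D phi).
case: (x \in D) (y \in D) Dxy => [] [] //= _ ef fe fg gf ge eg.
- exact: (no3 e f g kp (ef.2 isT) (fg.2 isT) (ge.2 isT)
    (fun a => notF (fe.1 a)) (fun a => notF (gf.1 a)) (fun a => notF (eg.1 a))).
- exact: (no3 e g f kp (eg.2 isT) (gf.2 isT) (fe.2 isT)
    (fun a => notF (ge.1 a)) (fun a => notF (fg.1 a)) (fun a => notF (ef.1 a))).
Qed.
End CompleteOutdegree.

(** * From proper Galvin orientations to Latin squares *)

(** An upper bound [K] on the number of colours suffices, since the outdegree bound k - 1 is at most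
    K - 1. *)
Lemma galvin_square_exists n k K :
  0 < k <= K -> K <= n <= K.+1 -> has_proper_galvin_orientation (complete n) k ->
  exists D c, @galvin_square n K D c /\ (K < n -> forall x, c x x = K :> nat).
Proof.
move=> /andP[k0 kK] /andP[Kn nK] [U [D [phi [UD disjUD col [kp deg]]]]].
have UE : U = ~: D.
  apply/setP=> x; rewrite inE; have := in_setT x; rewrite -UD inE.
  by have [xU _|_ /= ->//] := boolP (x \in U); rewrite (disjointFr disjUD xU).
pose c0 := pair_colour phi.
have c0_lt x y : x != y -> c0 x y < n.
  by move=> xy; apply: leq_trans (pair_colour_lt phi xy) _; lia.
(* If K = n - 1, every vertex misses the extra value K; if K = n, the n - 1 edges at [x] leave one
   of the n values free. *)
have missing x : exists j : 'I_n, (K < n -> j = K :> nat) /\ forall y, x != y -> c0 x y != j.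
  have [ltKn|leKn] := ltnP K n.
    exists (Ordinal ltKn); split => // y xy; rewrite neq_ltn /=.
    by rewrite (leq_trans (pair_colour_lt phi xy)).
  pose A := [set insubd x (c0 x y) | y in ~: [set x]].
  have A_lt : #|A| < n.
    apply: leq_ltn_trans (leq_imset_card _ _) _; rewrite cardsC1 card_ord.
    by have := ltn_ord x; lia.
  have /card_gt0P[j] : 0 < #|~: A| by rewrite cardsCs setCK card_ord subn_gt0.
  rewrite inE => jA; exists j; split=> [//|y xy].
  apply: contraNneq jA => E; apply/imsetP; exists y; first by rewrite !inE eq_sym.
  by apply: val_inj; rewrite val_insubd c0_lt.
(* Adds the row counts at the two ends of an edge, where [r] and [s] are the diagonal terms. *)
have double_le p q r s j : p + r = j -> q + s = j -> p + q <= K.-1 -> j.*2 <= K.-1 + r + s.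
  by clear; lia.
have [mu muP] := fin_all_exists missing.
pose c x y := if x == y then mu x else insubd x (c0 x y).
have c_diag x : c x x = mu x by rewrite /c eqxx.
have c_off x y : x != y -> c x y = c0 x y :> nat.
  by move=> xy; rewrite /c (negPf xy) val_insubd c0_lt.
have c_sym x y : c x y = c y x.
  have [->//|xy] := eqVneq x y; apply: val_inj; rewrite /= c_off // c_off 1?eq_sym //.
  exact: pair_colour_sym.
have c_inj x : injective (c x).
  move=> y z; case: (eqVneq x y) => [<-|xy]; case: (eqVneq x z) => [<-|xz] // /(congr1 val) /=.
  - by rewrite c_diag c_off // => E; have [_ /(_ z xz)] := muP x; rewrite -E eqxx.
  - by rewrite c_diag c_off // => E; have [_ /(_ y xy)] := muP x; rewrite E eqxx.
  by rewrite !c_off //; exact: pair_colour_inj.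
have deg_c x y : x != y -> #|out_neighbours U D phi x y| + #|out_neighbours U D phi y x| <= K.-1.
  move=> xy; have [e eE] := complete_edge_exists xy.
  by apply: leq_trans (outdegree_complete xy eE) (leq_trans (deg e) _); lia.
have outE x y : x != y -> out_neighbours U D phi x y =
    [set z | (z != x) && (if x \in D then c x z < c x y else c x y < c x z)].
  move=> xy; apply/setP=> z; rewrite !inE /pair_leaves_at UE inE; have [//|zx] := eqVneq z x.
  by rewrite (c_off x y) // (c_off x z) 1?eq_sym //; case: (x \in D); rewrite /= ?orbF.
exists D, c; split; last by move=> ltKn x; rewrite c_diag; apply: (muP x).1.
split => // [x y xD yD xy|x y xD yD xy|x y z yz Dyz Dxy].
- have yx : y != x by rewrite eq_sym.
  have := deg_c x y xy; rewrite !outE // xD yD (c_sym y x).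
  exact: double_le (card_row_lt_off c_inj x (c x y)) (card_row_lt_off c_inj y (c x y)).
- have yx : y != x by rewrite eq_sym.
  have := deg_c x y xy; rewrite !outE // (negPf xD) (negPf yD) (c_sym y x).
  exact: double_le (card_row_gt_off c_inj x (c x y)) (card_row_gt_off c_inj y (c x y)).
have xy : x != y by apply: contraNneq Dxy => ->.
have xz : x != z by apply: contraNneq Dxy => ->; rewrite Dyz.
by rewrite !c_off //; exact: (no_monotone_triangle UE kp).
Qed.

Theorem theorem5 (n : nat) (hn : 4 <= n) :
  ~ has_proper_galvin_orientation (complete n) (chromatic_index (complete n)).
Proof.
move=> proper.
have chi_gt0 : 0 < chromatic_index (complete n).
  have lt1n : 1 < n by exact: leq_trans hn.
  have ne : Ordinal (ltnW lt1n) != Ordinal lt1n by [].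
  have [_ [_ [phi _]]] := proper.
  by have [e _] := complete_edge_exists ne; exact: leq_ltn_trans (ltn_ord (phi e)).
(* The square is built with K = n for odd n and K = n - 1 for even n. *)
move: hn proper chi_gt0; rewrite -(odd_double_half n); move: n./2 (odd n) => m [] hn proper chi_gt0.
  have chi_le := chromatic_index_odd m; rewrite add1n in hn proper chi_gt0.
  have [||D [c [sq _]]] := galvin_square_exists (K := m.*2.+1) _ _ proper.
  - by rewrite chi_gt0.
  - by rewrite leqnn leqnSn.
  by apply: no_odd_square sq; lia.
rewrite add0n in hn proper chi_gt0.
have chi_le : chromatic_index (complete m.*2) <= m.*2.-1 by apply: chromatic_index_even; lia.
have [||D [c [sq diag]]] := galvin_square_exists (K := m.*2.-1) _ _ proper.
- by rewrite chi_gt0.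
- by lia.
by apply: no_even_square sq _ => [|x]; [lia | apply: diag; lia].
Qed.
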